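(* If $\Gamma\vdash M:\tau$ is derivable in $\mathsf{LEM}$ and $M\rightarrow M'$, then $\Gamma\vdash M':\tau$ is derivable in $\mathsf{LEM}$.
   Context: $\mathsf{LEM}$ is the following type-assignment system. Linear types: $A ::= \alpha \mid \sigma\multimap A \mid \forall\alpha.A$; types: $\sigma ::= A \mid \S\sigma$, where in $\S\sigma$ the type $\sigma$ must be closed and contain no negative occurrence of $\forall$ (standard polarity: in $\sigma\multimap A$ occurrences inside $\sigma$ reverse polarity; $\forall$ and $\S$ preserve it). A value is a closed $\beta$-normal linear $\lambda$-term of the pure $\lambda$-calculus. Terms: $M,N ::= x \mid \lambda x.M \mid MN \mid \mathtt{discard}_\sigma\,M\ \mathtt{in}\ N \mid \mathtt{copy}^V_\sigma\,M\ \mathtt{as}\ x,y\ \mathtt{in}\ N$ with $V$ a value ($x,y$ bound in $N$); only linear terms are used (free variables occur once, variables bound by $\lambda$ or $\mathtt{copy}$ occur in the body). Contexts are finite lists of typings of distinct variables; juxtaposing contexts requires disjoint domains. Rules: (ax) $x:A\vdash x:A$ with $A$ linear; (cut) from $\Gamma\vdash N:\sigma$ and $\Delta,x:\sigma\vdash M:\tau$ infer $\Gamma,\Delta\vdash M[N/x]:\tau$; ($\multimap$R) from $\Gamma,x:\sigma\vdash M:B$ infer $\Gamma\vdash\lambda x.M:\sigma\multimap B$; ($\multimap$L) from $\Gamma\vdash N:\sigma$ and $\Delta,x:B\vdash M:\tau$ infer $\Gamma,\Delta,y:\sigma\multimap B\vdash M[yN/x]:\tau$; ($\forall$R) from $\Gamma\vdash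 M:A\langle\gamma/\alpha\rangle$ with $\gamma$ not free in $\Gamma$ infer $\Gamma\vdash M:\forall\alpha.A$; ($\forall$L) from $\Gamma,x:A\langle B/\alpha\rangle\vdash M:\tau$ ($B$ linear) infer $\Gamma,x:\forall\alpha.A\vdash M:\tau$; ($p$) from $x_1:\S\sigma_1,\dots,x_n:\S\sigma_n\vdash M:\sigma$ infer the same with conclusion type $\S\sigma$; ($d$) from $\Gamma,x:\sigma\vdash M:\tau$ infer $\Gamma,y:\S\sigma\vdash M[y/x]:\tau$; ($w$) from $\Gamma\vdash M:\tau$ infer $\Gamma,x:\S\sigma\vdash \mathtt{discard}_\sigma\,x\ \mathtt{in}\ M:\tau$; ($c$) from $\Gamma,y:\S\sigma,z:\S\sigma\vdash M:\tau$ and $\vdash V:\sigma$ infer $\Gamma,x:\S\sigma\vdash\mathtt{copy}^V_\sigma\,x\ \mathtt{as}\ y,z\ \mathtt{in}\ M:\tau$. The one-step reduction $\rightarrow$ on terms is the closure under arbitrary term contexts of: $(\lambda x.M)N\rightarrow M[N/x]$; $\mathtt{discard}_\sigma\,V\ \mathtt{in}\ M\rightarrow M$ for $V$ a value; $\mathtt{copy}^U_\sigma\,V\ \mathtt{as}\ y,z\ \mathtt{in}\ M\rightarrow M[V/y,V/z]$ for $V$ a value; and the commuting conversions $(\mathtt{discard}_\sigma\,M\ \mathtt{in}\ N)P\rightarrow\mathtt{discard}_\sigma\,M\ \mathtt{in}\ (NP)$; $\mathtt{discard}_\sigma(\mathtt{discard}_\tau\,M\ \mathtt{in}\ N)\ \mathtt{in}\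 P\rightarrow\mathtt{discard}_\tau\,M\ \mathtt{in}\ (\mathtt{discard}_\sigma\,N\ \mathtt{in}\ P)$; $\mathtt{copy}^V_\sigma(\mathtt{discard}_\tau\,M\ \mathtt{in}\ N)\ \mathtt{as}\ y,z\ \mathtt{in}\ P\rightarrow\mathtt{discard}_\tau\,M\ \mathtt{in}\ (\mathtt{copy}^V_\sigma\,N\ \mathtt{as}\ y,z\ \mathtt{in}\ P)$; $(\mathtt{copy}^V_\sigma\,M\ \mathtt{as}\ y,z\ \mathtt{in}\ N)P\rightarrow\mathtt{copy}^V_\sigma\,M\ \mathtt{as}\ y,z\ \mathtt{in}\ (NP)$; $\mathtt{discard}_\sigma(\mathtt{copy}^V_\tau\,M\ \mathtt{as}\ y,z\ \mathtt{in}\ N)\ \mathtt{in}\ P\rightarrow\mathtt{copy}^V_\tau\,M\ \mathtt{as}\ y,z\ \mathtt{in}\ (\mathtt{discard}_\sigma\,N\ \mathtt{in}\ P)$; $\mathtt{copy}^U_\sigma(\mathtt{copy}^V_\tau\,M\ \mathtt{as}\ y,z\ \mathtt{in}\ N)\ \mathtt{as}\ y',z'\ \mathtt{in}\ P\rightarrow\mathtt{copy}^V_\tau\,M\ \mathtt{as}\ y,z\ \mathtt{in}\ (\mathtt{copy}^U_\sigma\,N\ \mathtt{as}\ y',z'\ \mathtt{in}\ P)$.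
   Formalization: In rule (∀R) the variable γ is required to be not free in ∀α.A as well as not free in Γ (the standard eigenvariable condition); without this, y:α ⊢ (λx.x)y:β would be derivable and the claim would fail. *)

(* Defs.v *)
From Stdlib Require Import List Arith Bool Permutation.
Import ListNotations.

(* Type variables are de Bruijn indices; the grammar is kept mutual so that
   codomains of arrows and bodies of quantifiers are linear types.  The side
   condition on [Par s] (closed, no negative quantifier) is [wf_ty]. *)
Inductive lty : Set :=
| TVar (a : nat)
| Arr (s : ty) (A : lty)
| All (A : lty)
with ty : Set :=
| Lin (A : lty)
| Par (s : ty).

Coercion Lin : lty >-> ty.

Definition up_ren (r : nat -> nat) (a : nat) : nat :=
  match a with 0 => 0 | S b => S (r b) end.

Fixpoint lty_ren (r : nat -> nat) (A : lty) : lty :=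
  match A with
  | TVar a => TVar (r a)
  | Arr s B => Arr (ty_ren r s) (lty_ren r B)
  | All B => All (lty_ren (up_ren r) B)
  end
with ty_ren (r : nat -> nat) (s : ty) : ty :=
  match s with
  | Lin A => Lin (lty_ren r A)
  | Par t => Par (ty_ren r t)
  end.

Definition up_sub (f : nat -> lty) (a : nat) : lty :=
  match a with 0 => TVar 0 | S b => lty_ren S (f b) end.

Fixpoint lty_sub (f : nat -> lty) (A : lty) : lty :=
  match A with
  | TVar a => f a
  | Arr s B => Arr (ty_sub f s) (lty_sub f B)
  | All B => All (lty_sub (up_sub f) B)
  end
with ty_sub (f : nat -> lty) (s : ty) : ty :=
  match s with
  | Lin A => Lin (lty_sub f A)
  | Par t => Par (ty_sub f t)
  end.

(* [lty_inst A B] is A<B/alpha>, where alpha is index 0 of A, the variable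
   bound by [All] in [All A]. *)
Definition lty_inst (A B : lty) : lty :=
  lty_sub (fun a => match a with 0 => B | S b => TVar b end) A.

(* All free indices are below [k]. *)
Fixpoint lty_closed_at (k : nat) (A : lty) : bool :=
  match A with
  | TVar a => a <? k
  | Arr s B => ty_closed_at k s && lty_closed_at k B
  | All B => lty_closed_at (S k) B
  end
with ty_closed_at (k : nat) (s : ty) : bool :=
  match s with
  | Lin A => lty_closed_at k A
  | Par t => ty_closed_at k t
  end.

(* Some quantifier occurs with polarity [p] ([true] for positive). *)
Fixpoint lty_occ_all (p : bool) (A : lty) : bool :=
  match A with
  | TVar _ => false
  | Arr s B => ty_occ_all (negb p) s || lty_occ_all p B
  | All B => p || lty_occ_all p B
  end
with ty_occ_all (p : bool) (s : ty) : bool :=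
  match s with
  | Lin A => lty_occ_all p A
  | Par t => ty_occ_all p t
  end.

Fixpoint wf_lty (A : lty) : bool :=
  match A with
  | TVar _ => true
  | Arr s B => wf_ty s && wf_lty B
  | All B => wf_lty B
  end
with wf_ty (s : ty) : bool :=
  match s with
  | Lin A => wf_lty A
  | Par t => wf_ty t && ty_closed_at 0 t && negb (ty_occ_all false t)
  end.

Notation var := nat (only parsing).

(* Locally nameless terms: free variables are names, bound ones are indices.
   [Copy s V M N] binds two indices in [N].  That [V] is a value and that the
   annotations are well formed is imposed by the typing rules introducing
   them, so it holds in every typable term; so does linearity. *)
Inductive term : Set :=
| FVar (x : var)
| BVar (i : nat)
| Lam (M : term)
| App (M N : term)
| Discard (s : ty) (M N : term)
| Copy (s : ty) (V M N : term).

(* Copy annotations are closed, hence ignored by the operations below. *)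

Fixpoint close (k : nat) (x : var) (M : term) : term :=
  match M with
  | FVar y => if x =? y then BVar k else FVar y
  | BVar i => BVar i
  | Lam P => Lam (close (S k) x P)
  | App P Q => App (close k x P) (close k x Q)
  | Discard s P Q => Discard s (close k x P) (close k x Q)
  | Copy s V P Q => Copy s V (close k x P) (close (2 + k) x Q)
  end.

(* Named abstractions, to be used with locally closed bodies: [lam x M] is
   \x.M and [copy s V M y z N] is copy^V_s M as y,z in N. *)
Definition lam (x : var) (M : term) : term := Lam (close 0 x M).

Definition copy (s : ty) (V M : term) (y z : var) (N : term) : term :=
  Copy s V M (close 1 z (close 0 y N)).

(* M[N/x]; capture-avoiding when [N] is locally closed. *)
Fixpoint subst (x : var) (N M : term) : term :=
  match M with
  | FVar y => if x =? y then N else FVar y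
  | BVar i => BVar i
  | Lam P => Lam (subst x N P)
  | App P Q => App (subst x N P) (subst x N Q)
  | Discard s P Q => Discard s (subst x N P) (subst x N Q)
  | Copy s V P Q => Copy s V (subst x N P) (subst x N Q)
  end.

(* Free variables, listed with multiplicity. *)
Fixpoint fv (M : term) : list var :=
  match M with
  | FVar x => [x]
  | BVar _ => []
  | Lam P => fv P
  | App P Q | Discard _ P Q | Copy _ _ P Q => fv P ++ fv Q
  end.

Fixpoint lc_at (k : nat) (M : term) : bool :=
  match M with
  | FVar _ => true
  | BVar i => i <? k
  | Lam P => lc_at (S k) P
  | App P Q | Discard _ P Q => lc_at k P && lc_at k Q
  | Copy _ _ P Q => lc_at k P && lc_at (2 + k) Q
  end.

Definition lc (M : term) : Prop := lc_at 0 M = true.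

Fixpoint pure (M : term) : bool :=
  match M with
  | FVar _ | BVar _ => true
  | Lam P => pure P
  | App P Q => pure P && pure Q
  | Discard _ _ _ | Copy _ _ _ _ => false
  end.

Definition is_lam (M : term) : bool :=
  match M with Lam _ => true | _ => false end.

Fixpoint beta_normal (M : term) : bool :=
  match M with
  | FVar _ | BVar _ => true
  | Lam P => beta_normal P
  | App P Q => negb (is_lam P) && beta_normal P && beta_normal Q
  | Discard _ P Q | Copy _ _ P Q => beta_normal P && beta_normal Q
  end.

(* Number of occurrences of the dangling index [k]. *)
Fixpoint bcount (k : nat) (M : term) : nat :=
  match M with
  | FVar _ => 0
  | BVar i => if i =? k then 1 else 0
  | Lam P => bcount (S k) P
  | App P Q | Discard _ P Q => bcount k P + bcount k Q
  | Copy _ _ P Q => bcount k P + bcount (2 + k) Q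
  end.

Fixpoint binders_linear (M : term) : bool :=
  match M with
  | FVar _ | BVar _ => true
  | Lam P => (bcount 0 P =? 1) && binders_linear P
  | App P Q | Discard _ P Q => binders_linear P && binders_linear Q
  | Copy _ _ P Q => (bcount 0 Q =? 1) && (bcount 1 Q =? 1)
                    && binders_linear P && binders_linear Q
  end.

Definition linear (M : term) : Prop :=
  NoDup (fv M) /\ binders_linear M = true.

Definition value (V : term) : Prop :=
  pure V = true /\ lc V /\ fv V = [] /\ beta_normal V = true /\ linear V.

Definition ctx := list (var * ty).

Definition dom (G : ctx) : list var := map fst G.

Definition ctx_shift (G : ctx) : ctx :=
  map (fun d => (fst d, ty_ren S (snd d))) G.

Definition is_par (s : ty) : Prop := exists t, s = Par t.

(* Contexts are taken up to reordering, whence [ty_exch].  Derivable contexts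
   declare distinct variables: the freshness premises below maintain this. *)
Inductive typing : ctx -> term -> ty -> Prop :=
| ty_ax (x : var) (A : lty) :
    wf_lty A = true ->
    typing [(x, Lin A)] (FVar x) A
| ty_cut (G D : ctx) (x : var) (N M : term) (s t : ty) :
    typing G N s ->
    typing ((x, s) :: D) M t ->
    NoDup (dom (G ++ D)) ->
    typing (G ++ D) (subst x N M) t
| ty_arrR (G : ctx) (x : var) (M : term) (s : ty) (B : lty) :
    typing ((x, s) :: G) M B ->
    typing G (lam x M) (Arr s B)
| ty_arrL (G D : ctx) (x y : var) (N M : term) (s : ty) (B : lty) (t : ty) :
    typing G N s ->
    typing ((x, Lin B) :: D) M t ->
    NoDup (y :: dom (G ++ D)) ->
    typing ((y, Lin (Arr s B)) :: G ++ D) (subst x (App (FVar y) N) M) t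
(* The eigenvariable is index 0, which does not occur in a shifted context. *)
| ty_allR (G : ctx) (M : term) (A : lty) :
    typing (ctx_shift G) M A ->
    typing G M (All A)
| ty_allL (G : ctx) (x : var) (M : term) (A B : lty) (t : ty) :
    wf_lty A = true -> wf_lty B = true ->
    typing ((x, Lin (lty_inst A B)) :: G) M t ->
    typing ((x, Lin (All A)) :: G) M t
| ty_p (G : ctx) (M : term) (s : ty) :
    wf_ty (Par s) = true ->
    Forall (fun d => is_par (snd d)) G ->
    typing G M s ->
    typing G M (Par s)
| ty_d (G : ctx) (x y : var) (M : term) (s t : ty) :
    wf_ty (Par s) = true ->
    typing ((x, s) :: G) M t ->
    ~ In y (dom G) ->
    typing ((y, Par s) :: G) (subst x (FVar y) M) t
| ty_w (G : ctx) (x : var) (M : term) (s t : ty) :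
    wf_ty (Par s) = true ->
    typing G M t ->
    ~ In x (dom G) ->
    typing ((x, Par s) :: G) (Discard s (FVar x) M) t
| ty_c (G : ctx) (x y z : var) (V M : term) (s t : ty) :
    typing ((y, Par s) :: (z, Par s) :: G) M t ->
    value V ->
    typing [] V s ->
    ~ In x (dom G) ->
    typing ((x, Par s) :: G) (copy s V (FVar x) y z M) t
| ty_exch (G D : ctx) (M : term) (t : ty) :
    Permutation G D ->
    typing G M t ->
    typing D M t.

(* The [lc] premises rule out dangling indices, which [lam] and [copy] would
   capture; the freshness premises are the usual conventions on bound names. *)
Inductive redex : term -> term -> Prop :=
| rx_beta x M N :
    lc M -> lc N ->
    redex (App (lam x M) N) (subst x N M)
| rx_discard s V M :
    value V -> lc M ->
    redex (Discard s V M) M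
| rx_copy s U V y z M :
    value V -> lc M -> y <> z ->
    redex (copy s U V y z M) (subst z V (subst y V M))
| rx_discard_app s M N P :
    lc M -> lc N -> lc P ->
    redex (App (Discard s M N) P) (Discard s M (App N P))
| rx_discard_discard s t M N P :
    lc M -> lc N -> lc P ->
    redex (Discard s (Discard t M N) P) (Discard t M (Discard s N P))
| rx_copy_discard s t V M N y z P :
    lc M -> lc N -> lc P -> y <> z ->
    redex (copy s V (Discard t M N) y z P) (Discard t M (copy s V N y z P))
| rx_copy_app s V M y z N P :
    lc M -> lc N -> lc P -> y <> z ->
    ~ In y (fv P) -> ~ In z (fv P) ->
    redex (App (copy s V M y z N) P) (copy s V M y z (App N P))
| rx_discard_copy s t V M y z N P :
    lc M -> lc N -> lc P -> y <> z ->
    ~ In y (fv P) -> ~ In z (fv P) ->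
    redex (Discard s (copy t V M y z N) P) (copy t V M y z (Discard s N P))
| rx_copy_copy s t U V M y z N y' z' P :
    lc M -> lc N -> lc P -> y <> z -> y' <> z' ->
    ~ In y (fv P) -> ~ In z (fv P) ->
    redex (copy s U (copy t V M y z N) y' z' P)
          (copy t V M y z (copy s U N y' z' P)).

Inductive step : term -> term -> Prop :=
| st_redex M M' :
    redex M M' -> step M M'
| st_lam x M M' :
    step M M' -> step (lam x M) (lam x M')
| st_appl M M' N :
    lc N -> step M M' -> step (App M N) (App M' N)
| st_appr M N N' :
    lc M -> step N N' -> step (App M N) (App M N')
| st_discardl s M M' N :
    lc N -> step M M' -> step (Discard s M N) (Discard s M' N)
| st_discardr s M N N' :
    lc M -> step N N' -> step (Discard s M N) (Discard s M N')
| st_copyl s V M M' y z N :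
    lc N -> y <> z -> step M M' ->
    step (copy s V M y z N) (copy s V M' y z N)
| st_copyr s V M y z N N' :
    lc M -> y <> z -> step N N' ->
    step (copy s V M y z N) (copy s V M y z N').

(* Main.v *)
(* Compare the sequent calculus with a natural deduction system [nd] in which the
   premises share one environment, so that linearity becomes a separate, untyped
   property of terms that reduction visibly preserves.  In [nd] the rules for
   [All] and [Par] leave the subject unchanged: those surrounding a discard or a
   copy can be pushed into its body, and those surrounding an abstraction can be
   reduced to introductions, since types may be substituted in derivations.  The
   only obstacle to substituting a term in a derivation is the side condition of
   the rule [p]; it is preserved because a term of type [Par s] has only
   hypotheses of such types.  Finally, a typing in [nd] of a linear term [M] is a
   sequent derivation whose context lists the free variables of [M]. *)
From Stdlib Require Import List Arith Bool Permutation Lia.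
Require Import Defs.
Import ListNotations.

(** * Type substitution *)

Scheme lty_mind := Induction for lty Sort Prop
with ty_mind := Induction for ty Sort Prop.
Combined Scheme lty_ty_ind from lty_mind, ty_mind.

Lemma lty_ty_sub_ext :
  (forall A f g, (forall a, f a = g a) -> lty_sub f A = lty_sub g A) /\
  (forall s f g, (forall a, f a = g a) -> ty_sub f s = ty_sub g s).
Proof.
  apply lty_ty_ind; simpl; intros; f_equal; auto.
  apply H; intros [|a]; simpl; auto; now rewrite H0.
Qed.

Lemma lty_ty_ren_sub :
  (forall A r, lty_ren r A = lty_sub (fun a => TVar (r a)) A) /\
  (forall s r, ty_ren r s = ty_sub (fun a => TVar (r a)) s).
Proof.
  apply lty_ty_ind; simpl; intros; f_equal; auto.
  rewrite H; apply lty_ty_sub_ext; intros [|a]; reflexivity.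
Qed.

Lemma lty_ty_sub_ren :
  (forall A f r, lty_sub f (lty_ren r A) = lty_sub (fun a => f (r a)) A) /\
  (forall s f r, ty_sub f (ty_ren r s) = ty_sub (fun a => f (r a)) s).
Proof.
  apply lty_ty_ind; simpl; intros; f_equal; auto.
  rewrite H; apply lty_ty_sub_ext; intros [|a]; reflexivity.
Qed.

Lemma lty_ren_up_S r A : lty_ren (up_ren r) (lty_ren S A) = lty_ren S (lty_ren r A).
Proof.
  rewrite (proj1 lty_ty_ren_sub (lty_ren S A)), (proj1 lty_ty_sub_ren),
    (proj1 lty_ty_ren_sub (lty_ren r A)), (proj1 lty_ty_sub_ren).
  reflexivity.
Qed.

Lemma lty_ty_ren_of_sub :
  (forall A f r, lty_ren r (lty_sub f A) = lty_sub (fun a => lty_ren r (f a)) A) /\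
  (forall s f r, ty_ren r (ty_sub f s) = ty_sub (fun a => lty_ren r (f a)) s).
Proof.
  apply lty_ty_ind; simpl; intros; f_equal; auto.
  rewrite H; apply lty_ty_sub_ext; intros [|a]; simpl; auto.
  apply lty_ren_up_S.
Qed.

Lemma lty_sub_up_S f A : lty_sub (up_sub f) (lty_ren S A) = lty_ren S (lty_sub f A).
Proof. now rewrite (proj1 lty_ty_sub_ren), (proj1 lty_ty_ren_of_sub). Qed.

Lemma ty_sub_up_S f s : ty_sub (up_sub f) (ty_ren S s) = ty_ren S (ty_sub f s).
Proof. now rewrite (proj2 lty_ty_sub_ren), (proj2 lty_ty_ren_of_sub). Qed.

Lemma lty_ty_sub_sub :
  (forall A f g, lty_sub g (lty_sub f A) = lty_sub (fun a => lty_sub g (f a)) A) /\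
  (forall s f g, ty_sub g (ty_sub f s) = ty_sub (fun a => lty_sub g (f a)) s).
Proof.
  apply lty_ty_ind; simpl; intros; f_equal; auto.
  rewrite H; apply lty_ty_sub_ext; intros [|a]; simpl; auto.
  apply lty_sub_up_S.
Qed.

(** The level [k] is there for the quantifier case, where [up_sub] fixes one more index; the
    applications take [k = 0]. *)
Lemma lty_ty_sub_closed :
  (forall A k f, lty_closed_at k A = true -> (forall a, a < k -> f a = TVar a) ->
     lty_sub f A = A) /\
  (forall s k f, ty_closed_at k s = true -> (forall a, a < k -> f a = TVar a) ->
     ty_sub f s = s).
Proof.
  apply lty_ty_ind; simpl; intros.
  - apply H0; now apply Nat.ltb_lt.
  - apply andb_prop in H1 as [? ?]; f_equal; eauto.
  - f_equal; eapply H; eauto.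
    intros [|a] Ha; simpl; auto; rewrite H1 by lia; reflexivity.
  - f_equal; eauto.
  - f_equal; eauto.
Qed.

Lemma lty_ty_sub_id :
  (forall A f, (forall a, f a = TVar a) -> lty_sub f A = A) /\
  (forall s f, (forall a, f a = TVar a) -> ty_sub f s = s).
Proof.
  apply lty_ty_ind; simpl; intros; f_equal; auto.
  apply H; intros [|a]; simpl; auto; now rewrite H0.
Qed.

(** The substitution inlined in [lty_inst], so that [lty_inst A B] is convertible to
    [lty_sub (inst B) A]. The name lets it act on types and environments too. *)
Definition inst (B : lty) (a : nat) : lty :=
  match a with 0 => B | S b => TVar b end.

Lemma ty_sub_inst_ren B s : ty_sub (inst B) (ty_ren S s) = s.
Proof. rewrite (proj2 lty_ty_sub_ren); now apply lty_ty_sub_id. Qed.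

Lemma lty_sub_inst f A B :
  lty_sub f (lty_inst A B) = lty_inst (lty_sub (up_sub f) A) (lty_sub f B).
Proof.
  unfold lty_inst; rewrite !(proj1 lty_ty_sub_sub); apply lty_ty_sub_ext.
  intros [|a]; simpl; auto.
  rewrite (proj1 lty_ty_sub_ren); symmetry; now apply lty_ty_sub_id.
Qed.

Lemma wf_par_closed s : wf_ty (Par s) = true -> ty_closed_at 0 s = true.
Proof. simpl; intros H; apply andb_prop in H as [H _]; now apply andb_prop in H as [_ H]. Qed.

Lemma wf_par_wf s : wf_ty (Par s) = true -> wf_ty s = true.
Proof. simpl; intros H; apply andb_prop in H as [H _]; now apply andb_prop in H as [H _]. Qed.

(** The body of a well-formed [Par] is closed. Hence the annotations of discards and copies are
    insensitive to type substitution, and so are the polarity conditions. *)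
Lemma ty_sub_wf_par f s : wf_ty (Par s) = true -> ty_sub f s = s.
Proof.
  intros H; apply (proj2 lty_ty_sub_closed) with 0; [now apply wf_par_closed|lia].
Qed.

Lemma ty_ren_wf_par r s : wf_ty (Par s) = true -> ty_ren r s = s.
Proof. rewrite (proj2 lty_ty_ren_sub); apply ty_sub_wf_par. Qed.

Lemma wf_lty_ty_ren :
  (forall A r, wf_lty A = true -> wf_lty (lty_ren r A) = true) /\
  (forall s r, wf_ty s = true -> wf_ty (ty_ren r s) = true).
Proof.
  apply lty_ty_ind; intros; try (simpl in *; auto; fail).
  - simpl in *; apply andb_prop in H1 as [? ?]; apply andb_true_intro; auto.
  - cbn [ty_ren]; now rewrite ty_ren_wf_par.
Qed.

Lemma wf_lty_ty_sub :
  (forall A f, wf_lty A = true -> (forall a, wf_lty (f a) = true) ->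
     wf_lty (lty_sub f A) = true) /\
  (forall s f, wf_ty s = true -> (forall a, wf_lty (f a) = true) ->
     wf_ty (ty_sub f s) = true).
Proof.
  apply lty_ty_ind; intros; try (simpl in *; auto; fail).
  - simpl in *; apply andb_prop in H1 as [? ?]; apply andb_true_intro; auto.
  - simpl in *; apply H; auto; intros [|a]; simpl; auto; now apply wf_lty_ty_ren.
  - cbn [ty_sub]; now rewrite ty_sub_wf_par.
Qed.

Lemma wf_inst B : wf_lty B = true -> forall a, wf_lty (inst B a) = true.
Proof. intros H [|a]; simpl; auto. Qed.

Lemma wf_ty_ren_inv s : wf_ty (ty_ren S s) = true -> wf_ty s = true.
Proof.
  (* Instantiating index 0 undoes the shift; any well-formed linear type would serve in place of
     [TVar 0]. *)
  intros H; rewrite <- (ty_sub_inst_ren (TVar 0) s).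
  apply wf_lty_ty_sub; auto; now apply wf_inst.
Qed.

Lemma is_par_sub f s : is_par s -> is_par (ty_sub f s).
Proof. intros [t ->]; now exists (ty_sub f t). Qed.

(** * Occurrence counts *)

Definition fcount (x : nat) (M : term) : nat := count_occ Nat.eq_dec (fv M) x.

Lemma count_occ_cons_eqb y l x :
  count_occ Nat.eq_dec (y :: l) x = (if y =? x then 1 else 0) + count_occ Nat.eq_dec l x.
Proof. simpl; destruct (Nat.eq_dec y x), (Nat.eqb_spec y x); congruence || auto. Qed.

Lemma fcount_FVar x y : fcount x (FVar y) = if y =? x then 1 else 0.
Proof. unfold fcount; simpl fv; rewrite count_occ_cons_eqb; apply Nat.add_0_r. Qed.

Lemma fcount_BVar x i : fcount x (BVar i) = 0.
Proof. reflexivity. Qed.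

Lemma fcount_Lam x P : fcount x (Lam P) = fcount x P.
Proof. reflexivity. Qed.

Lemma fcount_App x P Q : fcount x (App P Q) = fcount x P + fcount x Q.
Proof. apply count_occ_app. Qed.

Lemma fcount_Discard x s P Q : fcount x (Discard s P Q) = fcount x P + fcount x Q.
Proof. apply count_occ_app. Qed.

Lemma fcount_Copy x s V P Q : fcount x (Copy s V P Q) = fcount x P + fcount x Q.
Proof. apply count_occ_app. Qed.

#[local] Hint Rewrite fcount_FVar fcount_BVar fcount_Lam fcount_App fcount_Discard
  fcount_Copy : fc.

Lemma fcount_In x M : In x (fv M) <-> 0 < fcount x M.
Proof. unfold fcount; rewrite (count_occ_In Nat.eq_dec); lia. Qed.

Lemma fcount_notIn x M : ~ In x (fv M) <-> fcount x M = 0.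
Proof. rewrite fcount_In; lia. Qed.

Ltac eqbs :=
  repeat match goal with
  | |- context [?a =? ?b] => destruct (Nat.eqb_spec a b); subst
  | H : context [?a =? ?b] |- _ => destruct (Nat.eqb_spec a b); subst
  end.

Ltac split_andb :=
  repeat match goal with
  | H : _ && _ = true |- _ => apply andb_prop in H as [? ?]
  end.

Lemma lc_at_bcount M : forall k i, lc_at k M = true -> k <= i -> bcount i M = 0.
Proof.
  induction M; simpl; intros k j H Hk; split_andb; auto.
  - apply Nat.ltb_lt in H; destruct (Nat.eqb_spec i j); lia.
  - apply IHM with (S k); auto; lia.
  - now rewrite (IHM1 k), (IHM2 k).
  - now rewrite (IHM1 k), (IHM2 k).
  - rewrite (IHM2 k), (IHM3 (2 + k)); auto; lia.
Qed.

Lemma lc_bcount M i : lc M -> bcount i M = 0.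
Proof. intros; apply lc_at_bcount with 0; auto; lia. Qed.

Lemma lc_at_le M : forall j k, j <= k -> lc_at j M = true -> lc_at k M = true.
Proof.
  induction M; simpl; intros j k Hjk H; split_andb; auto.
  - apply Nat.ltb_lt in H; apply Nat.ltb_lt; lia.
  - apply IHM with (S j); auto; lia.
  - rewrite (IHM1 j), (IHM2 j); auto.
  - rewrite (IHM1 j), (IHM2 j); auto.
  - rewrite (IHM2 j), (IHM3 (S (S j))); auto; lia.
Qed.

Lemma fcount_close y x M : forall k,
  fcount y (close k x M) = if x =? y then 0 else fcount y M.
Proof.
  induction M; intros k; simpl; autorewrite with fc;
    rewrite ?IHM, ?IHM1, ?IHM2, ?IHM3; try (destruct (x =? y); reflexivity).
  destruct (Nat.eqb_spec x x0); subst; autorewrite with fc; eqbs; lia.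
Qed.

Lemma bcount_close x M : forall j k,
  bcount j (close k x M) = bcount j M + if j =? k then fcount x M else 0.
Proof.
  induction M; intros j k; simpl; autorewrite with fc;
    rewrite ?IHM, ?IHM1, ?IHM2, ?IHM3; simpl; try (eqbs; lia).
  destruct (Nat.eqb_spec x x0); subst; simpl; eqbs; lia.
Qed.

(** Below a binder of [M] the new index lies strictly above those bound there, so none of the counts
    tested by [binders_linear] changes. *)
Lemma binders_linear_close x M : forall k,
  binders_linear (close k x M) = binders_linear M.
Proof.
  induction M; intros k; simpl; rewrite ?bcount_close, ?IHM, ?IHM1, ?IHM2, ?IHM3;
    simpl; rewrite ?Nat.add_0_r; auto.
  now destruct (x =? x0).
Qed.

Lemma lc_at_close x M : forall k,
  lc_at k M = true -> lc_at (S k) (close k x M) = true.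
Proof.
  induction M; simpl; intros k H; split_andb.
  - destruct (x =? x0); simpl; auto. apply Nat.ltb_lt; lia.
  - apply Nat.ltb_lt in H; apply Nat.ltb_lt; lia.
  - now apply IHM.
  - now rewrite IHM1, IHM2.
  - now rewrite IHM1, IHM2.
  - now rewrite IHM2, IHM3.
Qed.

Lemma close_fresh x M : forall k, fcount x M = 0 -> close k x M = M.
Proof.
  induction M; simpl; intros k; autorewrite with fc; intros H; f_equal; auto;
    try (apply IHM1; lia); try (apply IHM2; lia); try (apply IHM3; lia).
  destruct (Nat.eqb_spec x x0); auto. subst; rewrite Nat.eqb_refl in H; lia.
Qed.

Lemma fcount_subst y x N M :
  fcount y (subst x N M) =
  (if x =? y then 0 else fcount y M) + fcount x M * fcount y N.
Proof.
  induction M; simpl; autorewrite with fc;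
    rewrite ?IHM, ?IHM1, ?IHM2, ?IHM3; try (destruct (x =? y); lia).
  destruct (Nat.eqb_spec x x0); subst; autorewrite with fc; eqbs; try lia.
Qed.

Lemma bcount_subst x N M : lc N -> forall j, bcount j (subst x N M) = bcount j M.
Proof.
  intros HN; induction M; simpl; intros; auto.
  destruct (x =? x0); simpl; auto. now apply lc_bcount.
Qed.

Lemma binders_linear_subst x N M :
  lc N -> binders_linear N = true -> binders_linear M = true ->
  binders_linear (subst x N M) = true.
Proof.
  intros HN LN; induction M; simpl; intros H; rewrite ?bcount_subst by auto;
    split_andb; rewrite ?andb_true_iff; auto 6.
  now destruct (x =? x0).
Qed.

Lemma lc_at_subst x N M : lc N -> forall k,
  lc_at k M = true -> lc_at k (subst x N M) = true.
Proof.
  intros HN; induction M; simpl; intros k H; split_andb; rewrite ?andb_true_iff; auto.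
  destruct (x =? x0); simpl; auto. apply lc_at_le with 0; auto; lia.
Qed.

Lemma subst_fresh x N M : fcount x M = 0 -> subst x N M = M.
Proof.
  induction M; simpl; autorewrite with fc; intros H; f_equal; auto;
    try (apply IHM1; lia); try (apply IHM2; lia); try (apply IHM3; lia).
  destruct (Nat.eqb_spec x x0); auto. subst; rewrite Nat.eqb_refl in H; lia.
Qed.

Lemma subst_self x M : subst x (FVar x) M = M.
Proof. induction M; simpl; f_equal; auto. destruct (Nat.eqb_spec x x0); congruence. Qed.

(* No index is lowered: the dangling index [k] simply disappears. *)
Fixpoint open (k : nat) (N M : term) : term :=
  match M with
  | FVar y => FVar y
  | BVar i => if i =? k then N else BVar i
  | Lam P => Lam (open (S k) N P)
  | App P Q => App (open k N P) (open k N Q)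
  | Discard s P Q => Discard s (open k N P) (open k N Q)
  | Copy s V P Q => Copy s V (open k N P) (open (2 + k) N Q)
  end.

(** Substitution for a name thus factors through an index, which leaves [nd_open] as the only
    substitution argument on derivations. A dangling [k] already in [M] would be filled together
    with [x]. *)
Lemma open_close x N M : forall k,
  bcount k M = 0 -> open k N (close k x M) = subst x N M.
Proof.
  induction M; simpl; intros k H; f_equal; auto;
    try (apply IHM1; lia); try (apply IHM2; lia); try (apply IHM3; lia).
  - destruct (x =? x0); simpl; auto. now rewrite Nat.eqb_refl.
  - now destruct (i =? k).
Qed.

Lemma close_open x M : forall k, fcount x M = 0 -> close k x (open k (FVar x) M) = M.
Proof.
  induction M; simpl; intros k; autorewrite with fc; intros H; f_equal; auto;
    try (apply IHM1; lia); try (apply IHM2; lia); try (apply IHM3; lia).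
  - eqbs; congruence.
  - destruct (Nat.eqb_spec i k); simpl; subst; auto. now rewrite Nat.eqb_refl.
Qed.

Lemma fcount_open y N M : forall k,
  fcount y (open k N M) = fcount y M + bcount k M * fcount y N.
Proof.
  induction M; intros k; simpl; autorewrite with fc;
    rewrite ?IHM, ?IHM1, ?IHM2, ?IHM3; simpl; try lia.
  destruct (i =? k); autorewrite with fc; lia.
Qed.

Lemma bcount_open N M : lc N -> forall j k,
  bcount j (open k N M) = if j =? k then 0 else bcount j M.
Proof.
  intros HN; induction M; intros j k; simpl;
    rewrite ?IHM, ?IHM1, ?IHM2, ?IHM3; simpl; try (destruct (j =? k); auto; fail).
  destruct (Nat.eqb_spec i k); simpl.
  - rewrite lc_bcount by auto; eqbs; lia.
  - eqbs; congruence.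
Qed.

Lemma binders_linear_open x M : forall k,
  binders_linear (open k (FVar x) M) = binders_linear M.
Proof.
  induction M; intros k; simpl; rewrite ?bcount_open, ?IHM, ?IHM1, ?IHM2, ?IHM3
    by reflexivity; simpl; auto.
  now destruct (i =? k).
Qed.

Lemma lc_at_open x M : forall k,
  lc_at (S k) M = true -> lc_at k (open k (FVar x) M) = true.
Proof.
  induction M; simpl; intros k H; split_andb; rewrite ?andb_true_iff; auto.
  apply Nat.ltb_lt in H; destruct (Nat.eqb_spec i k); simpl; auto.
  apply Nat.ltb_lt; lia.
Qed.

Fixpoint size (M : term) : nat :=
  match M with
  | FVar _ | BVar _ => 0
  | Lam P => S (size P)
  | App P Q | Discard _ P Q | Copy _ _ P Q => S (size P + size Q)
  end.

Lemma size_open x M : forall k, size (open k (FVar x) M) = size M.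
Proof.
  induction M; intros k; simpl; rewrite ?IHM, ?IHM1, ?IHM2, ?IHM3; auto.
  now destruct (i =? k).
Qed.

(** * Natural deduction without context splitting *)

Definition env := nat -> ty.

Definition scons (s : ty) (F : env) : env :=
  fun i => match i with 0 => s | S j => F j end.

Definition upd (E : env) (x : nat) (s : ty) : env :=
  fun y => if x =? y then s else E y.

Definition shift (E : env) : env := fun x => ty_ren S (E x).

Definition tsub (f : nat -> lty) (E : env) : env := fun x => ty_sub f (E x).

(** The side condition of rule [p]. Environments are total, so it concerns only the variables that
    occur in [M]. *)
Definition par_env (E F : env) (M : term) : Prop :=
  (forall x, In x (fv M) -> is_par (E x)) /\
  (forall i, 0 < bcount i M -> is_par (F i)).

(* [E] types the free names and [F] the dangling indices.  Contexts are shared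
   by all premises: linearity is a separate, untyped property of the subject. *)
Inductive nd : env -> env -> term -> ty -> Prop :=
| nd_fvar E F x : wf_ty (E x) = true -> nd E F (FVar x) (E x)
| nd_bvar E F i : nd E F (BVar i) (F i)
| nd_lam E F P s B :
    wf_ty s = true -> nd E (scons s F) P (Lin B) -> nd E F (Lam P) (Arr s B)
| nd_app E F M N s B :
    nd E F M (Arr s B) -> nd E F N s -> nd E F (App M N) B
| nd_discard E F s M N t :
    wf_ty (Par s) = true -> nd E F M (Par s) -> nd E F N t ->
    nd E F (Discard s M N) t
| nd_copy E F s V M Q t :
    wf_ty (Par s) = true -> value V -> typing [] V s ->
    nd E F M (Par s) -> nd E (scons (Par s) (scons (Par s) F)) Q t ->
    nd E F (Copy s V M Q) t
| nd_allI E F M A : nd (shift E) (shift F) M (Lin A) -> nd E F M (All A)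
| nd_allE E F M A B :
    wf_lty B = true -> nd E F M (All A) -> nd E F M (lty_inst A B)
| nd_p E F M s :
    wf_ty (Par s) = true -> par_env E F M -> nd E F M s -> nd E F M (Par s)
| nd_d E F M s : nd E F M (Par s) -> nd E F M s.

Definition nd_core (E F : env) (M : term) (t : ty) : Prop :=
  match M with
  | FVar x => wf_ty (E x) = true /\ t = E x
  | BVar i => t = F i
  | Lam P => exists s B, t = Arr s B /\ wf_ty s = true /\ nd E (scons s F) P (Lin B)
  | App M N => exists s (B : lty), t = B /\ nd E F M (Arr s B) /\ nd E F N s
  | Discard s M N => wf_ty (Par s) = true /\ nd E F M (Par s) /\ nd E F N t
  | Copy s V M Q =>
      wf_ty (Par s) = true /\ value V /\ typing [] V s /\
      nd E F M (Par s) /\ nd E (scons (Par s) (scons (Par s) F)) Q t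
  end.

(* The last four rules leave the subject unchanged, so a property of the types
   of one term only has to be checked for them and for one more rule. *)
Lemma nd_silent_ind (M : term) (R : env -> env -> ty -> Prop) :
  (forall E F t, nd_core E F M t -> R E F t) ->
  (forall E F A, R (shift E) (shift F) (Lin A) -> R E F (All A)) ->
  (forall E F A B, wf_lty B = true -> R E F (All A) -> R E F (lty_inst A B)) ->
  (forall E F s, wf_ty (Par s) = true -> par_env E F M -> R E F s -> R E F (Par s)) ->
  (forall E F s, R E F (Par s) -> R E F s) ->
  forall E F t, nd E F M t -> R E F t.
Proof.
  intros Hcore HallI HallE Hp Hd E F t H; induction H; auto;
    apply Hcore; simpl; eauto 8.
Qed.

(** Weakening and strengthening at once: every rule, including the side condition of [p], consults
    the environments only on variables occurring in the subject. *)
Lemma nd_ext E F M t : nd E F M t -> forall E' F',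
  (forall x, In x (fv M) -> E x = E' x) ->
  (forall i, 0 < bcount i M -> F i = F' i) ->
  nd E' F' M t.
Proof.
  induction 1; intros E' F' HE HF; simpl in *.
  - rewrite HE in * by auto; now constructor.
  - rewrite HF by (rewrite Nat.eqb_refl; lia); constructor.
  - constructor; auto; apply IHnd; auto; intros [|i] Hi; simpl; auto.
  - econstructor; [apply IHnd1|apply IHnd2]; intros; try apply HE, in_or_app;
      try apply HF; auto; lia.
  - constructor; [auto|apply IHnd1|apply IHnd2]; intros; try apply HE, in_or_app;
      try apply HF; auto; lia.
  - constructor; [auto|auto|auto|apply IHnd1|apply IHnd2]; intros;
      try apply HE, in_or_app; try apply HF; auto; try lia.
    destruct i as [|[|i]]; simpl; auto; apply HF; lia.
  - constructor; apply IHnd; intros; unfold shift; f_equal; auto.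
  - constructor; auto.
  - constructor; auto. destruct H0; split; intros.
    + rewrite <- HE by auto; auto.
    + rewrite <- HF by auto; auto.
  - apply nd_d; auto.
Qed.

(** The subject stays the same because its annotations are closed; for the same reason the premise
    [typing [] V s] of a copy is reused as it is. *)
Lemma nd_tsub E F M t : nd E F M t -> forall f, (forall a, wf_lty (f a) = true) ->
  nd (tsub f E) (tsub f F) M (ty_sub f t).
Proof.
  induction 1; intros f Hf.
  - apply (nd_fvar (tsub f E)); apply wf_lty_ty_sub; auto.
  - apply (nd_bvar (tsub f E) (tsub f F)).
  - simpl; constructor; [apply wf_lty_ty_sub; auto|].
    eapply nd_ext; [apply IHnd; auto|auto|].
    intros [|i] _; reflexivity.
  - econstructor; [apply IHnd1|apply IHnd2]; auto.
  - constructor; auto. rewrite <- (ty_sub_wf_par f s) by auto; now apply IHnd1.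
  - constructor; auto.
    + rewrite <- (ty_sub_wf_par f s) by auto; now apply IHnd1.
    + eapply nd_ext; [apply IHnd2; auto|auto|].
      intros [|[|i]] _; unfold tsub; simpl; auto; now rewrite ty_sub_wf_par.
  - simpl; constructor; eapply nd_ext; [apply (IHnd (up_sub f))| |].
    + intros [|a]; simpl; auto; now apply wf_lty_ty_ren.
    + intros; apply ty_sub_up_S.
    + intros; apply ty_sub_up_S.
  - simpl; rewrite lty_sub_inst; apply nd_allE.
    + now apply wf_lty_ty_sub.
    + now apply IHnd.
  - simpl. specialize (IHnd f Hf); rewrite ty_sub_wf_par in * by auto.
    constructor; auto. destruct H0; split; intros; apply is_par_sub; auto.
  - apply nd_d; now apply IHnd.
Qed.

(** Instantiates the eigenvariable of a quantifier introduction, which occurs in neither shifted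
    environment. *)
Lemma nd_unshift E F M t B : wf_lty B = true ->
  nd (shift E) (shift F) M t -> nd E F M (ty_sub (inst B) t).
Proof.
  intros HB H; eapply nd_ext; [apply nd_tsub; [exact H|now apply wf_inst]| |];
    intros; apply ty_sub_inst_ren.
Qed.

Lemma nd_shift E F M t : nd E F M t -> nd (shift E) (shift F) M (ty_ren S t).
Proof.
  intros H; rewrite (proj2 lty_ty_ren_sub).
  eapply nd_ext; [apply nd_tsub; [exact H|reflexivity]| |];
    intros; symmetry; apply (proj2 lty_ty_ren_sub).
Qed.

(* Arrows and quantifiers have linear codomains, so a linear hypothesis can
   never be consumed on the way to a type [Par s]. *)
Lemma nd_par_env E F M s : nd E F M (Par s) -> par_env E F M.
Proof.
  intros H; remember (Par s) as t eqn:Ht; revert s Ht.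
  induction H; intros s0 Ht; try discriminate; eauto.
  - split; simpl; [intros y [<-|[]]; rewrite Ht; now exists s0|lia].
  - split; simpl; [intros y []|].
    intros j Hj; destruct (Nat.eqb_spec i j); [|lia]; subst; rewrite Ht; now exists s0.
  - destruct (IHnd1 _ eq_refl), (IHnd2 _ Ht); split; simpl; intros.
    + apply in_app_or in H6 as []; auto.
    + destruct (Nat.eq_dec (bcount i M) 0); [apply H5|apply H3]; lia.
  - destruct (IHnd1 _ eq_refl), (IHnd2 _ Ht); split; simpl; intros.
    + apply in_app_or in H8 as []; auto.
    + destruct (Nat.eq_dec (bcount i M) 0); [apply (H7 (S (S i)))|apply H5]; lia.
Qed.

(** Since [N] is locally closed, its environment [F0] for dangling indices is immaterial, and [N]
    can be carried unchanged under binders. *)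
Lemma nd_open E F P t : nd E F P t -> forall k N F0,
  lc N -> nd E F0 N (F k) -> nd E F (open k N P) t.
Proof.
  induction 1; intros k N0 F0 HN0 HN; simpl.
  - now constructor.
  - destruct (Nat.eqb_spec i k); [subst|constructor].
    eapply nd_ext; eauto; intros; rewrite lc_bcount in *; auto; lia.
  - constructor; auto; eapply IHnd; eauto.
  - econstructor; eauto.
  - constructor; eauto.
  - constructor; eauto.
  - constructor; eapply IHnd; eauto. apply nd_shift; eauto.
  - constructor; eauto.
  - constructor; eauto. destruct H0 as [HE HF]; split; intros.
    + rewrite fcount_In, fcount_open in H0.
      destruct (Nat.eq_dec (fcount x M) 0).
      (* Here [x] comes from [N], so the index [k] occurs in [M] and its type is some [Par u]. By
         [nd_par_env] all hypotheses of [N] are then of such types. *)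
      * destruct (HF k) as [u Hu]; [lia|]. rewrite Hu in HN.
        apply nd_par_env in HN as [HN _]; apply HN, fcount_In; lia.
      * apply HE, fcount_In; lia.
    + rewrite bcount_open in H0 by auto; destruct (i =? k); [lia|auto].
  - apply nd_d; eauto.
Qed.

Lemma nd_close E F M t : nd E F M t -> forall k x F',
  bcount k M = 0 -> F' k = E x -> (forall i, 0 < bcount i M -> F' i = F i) ->
  nd E F' (close k x M) t.
Proof.
  induction 1; intros k x0 F' Hk HFk HF; simpl in *.
  - destruct (Nat.eqb_spec x0 x); subst; [rewrite <- HFk|]; now constructor.
  - rewrite <- HF by (rewrite Nat.eqb_refl; lia); constructor.
  - constructor; auto; apply IHnd; auto. intros [|i] Hi; simpl; auto.
  - econstructor; [apply IHnd1|apply IHnd2]; auto; try lia; intros; apply HF; lia.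
  - constructor; [auto|apply IHnd1|apply IHnd2]; auto; try lia; intros; apply HF; lia.
  - constructor; [auto|auto|auto|apply IHnd1|apply IHnd2]; auto; try lia.
    + intros; apply HF; lia.
    + intros [|[|i]] Hi; simpl; auto; apply HF; lia.
  - constructor; apply IHnd; auto.
    + unfold shift; congruence.
    + intros; unfold shift; f_equal; auto.
  - constructor; eauto.
  - constructor; eauto. destruct H0 as [HE HF0]; split; intros.
    + apply HE, fcount_In. apply fcount_In in H0; rewrite fcount_close in H0.
      destruct (x0 =? x); lia.
    + rewrite bcount_close in H0. destruct (Nat.eq_dec (bcount i M) 0).
      * destruct (Nat.eqb_spec i k); [subst|lia].
        rewrite HFk; apply HE, fcount_In; lia.
      * rewrite HF by lia; apply HF0; lia.
  - apply nd_d; eauto.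
Qed.

(** Opening [close k x M] with the variable [x] itself gives back [M], so this is an instance of
    [nd_open]. The closed body no longer contains [x], which leaves [E] free to be updated there. *)
Lemma nd_unclose E F M t k x : nd E F (close k x M) t ->
  bcount k M = 0 -> wf_ty (F k) = true -> nd (upd E x (F k)) F M t.
Proof.
  intros H Hk Hwf; rewrite <- (subst_self x M), <- (open_close x _ M k) by auto.
  apply nd_open with (F0 := F).
  - eapply nd_ext; [exact H| |auto].
    intros y; rewrite fcount_In, fcount_close; unfold upd.
    destruct (x =? y); [lia|auto].
  - reflexivity.
  - assert (Hx : upd E x (F k) x = F k) by (unfold upd; now rewrite Nat.eqb_refl).
    rewrite <- Hx at 2; constructor; now rewrite Hx.
Qed.

Lemma nd_close_upd E F F' M t k x s : nd (upd E x s) F M t ->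
  bcount k M = 0 -> F' k = s -> (forall i, 0 < bcount i M -> F' i = F i) ->
  nd E F' (close k x M) t.
Proof.
  intros H Hk Hs HF; apply nd_ext with (upd E x s) F'; auto.
  - eapply nd_close; eauto. unfold upd; now rewrite Nat.eqb_refl.
  - intros y; rewrite fcount_In, fcount_close; unfold upd.
    destruct (x =? y); [lia|auto].
Qed.

Lemma nd_lc E F F' M t : lc M -> nd E F M t -> nd E F' M t.
Proof.
  intros Hlc H; eapply nd_ext; eauto; intros i Hi; rewrite lc_bcount in Hi; auto; lia.
Qed.

(** Close [x] to index 0, then open that index with [N]. *)
Lemma nd_subst E F M N s t x : nd (upd E x s) F M t -> nd E F N s ->
  lc M -> lc N -> nd E F (subst x N M) t.
Proof.
  intros HM HN LM LN; rewrite <- (open_close x N M 0) by now apply lc_bcount.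
  apply nd_lc with (scons s F).
  { unfold lc; rewrite open_close by now apply lc_bcount. now apply lc_at_subst. }
  eapply nd_open; eauto.
  eapply nd_close_upd; eauto using lc_bcount.
  intros i Hi; rewrite lc_bcount in Hi; auto; lia.
Qed.

(** * Passing between indices and names under a binder *)

Lemma nd_lam_name E F M s B x : nd E (scons s F) (close 0 x M) (Lin B) ->
  lc M -> wf_ty s = true -> nd (upd E x s) F M B.
Proof.
  intros H LM Hs; apply nd_lc with (scons s F); auto.
  apply (nd_unclose _ _ _ _ _ _ H); auto using lc_bcount.
Qed.

Lemma nd_name_lam E F M s B x : nd (upd E x s) F M (Lin B) -> lc M ->
  nd E (scons s F) (close 0 x M) B.
Proof.
  intros H LM; eapply nd_close_upd; eauto using lc_bcount.
  intros i Hi; rewrite lc_bcount in Hi; auto; lia.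
Qed.

Lemma nd_copy_name E F M s t y z :
  nd E (scons s (scons s F)) (close 1 z (close 0 y M)) t ->
  lc M -> wf_ty s = true -> nd (upd (upd E z s) y s) F M t.
Proof.
  intros H LM Hs; apply nd_lc with (scons s (scons s F)); auto.
  apply nd_unclose in H; auto.
  - apply nd_unclose in H; auto using lc_bcount.
  - rewrite bcount_close, lc_bcount; auto.
Qed.

Lemma nd_name_copy E F M s t y z :
  nd (upd (upd E z s) y s) F M t -> lc M ->
  nd E (scons s (scons s F)) (close 1 z (close 0 y M)) t.
Proof.
  intros H LM.
  apply nd_close_upd with (F := scons s (scons s F)) (s := s); auto.
  - eapply nd_close_upd; eauto using lc_bcount.
    intros i Hi; rewrite lc_bcount in Hi; auto; lia.
  - rewrite bcount_close, lc_bcount; auto.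
Qed.

(** * Generation *)

(* The types of [Lam P] obtained by introduction rules only. *)
Fixpoint lam_lty (E F : env) (P : term) (A : lty) : Prop :=
  match A with
  | TVar _ => False
  | Arr s B => wf_ty s = true /\ nd E (scons s F) P (Lin B)
  | All B => lam_lty (shift E) (shift F) P B
  end.

(** The modality is skipped: [p] and [d] put no condition on the way the abstraction below them is
    introduced. *)
Fixpoint lam_ty (E F : env) (P : term) (t : ty) : Prop :=
  match t with
  | Lin A => lam_lty E F P A
  | Par s => lam_ty E F P s
  end.

Lemma lam_lty_tsub A P : forall E F E' F' g,
  (forall a, wf_lty (g a) = true) -> lam_lty E F P A ->
  (forall x, E' x = tsub g E x) -> (forall i, F' i = tsub g F i) ->
  lam_lty E' F' P (lty_sub g A).
Proof.
  induction A as [a|s B IH|B IH]; simpl; intros E F E' F' g Hg H HE HF.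
  - easy.
  - destruct H as [Hs H]; split; [now apply wf_lty_ty_sub|].
    eapply nd_ext; [apply (nd_tsub _ _ _ _ H g Hg)|auto|].
    intros [|i] _; unfold tsub; simpl; auto; now rewrite HF.
  - eapply IH; [|exact H| |].
    + intros [|a]; simpl; auto; now apply wf_lty_ty_ren.
    + intros x; unfold shift, tsub; rewrite HE; symmetry; apply ty_sub_up_S.
    + intros x; unfold shift, tsub; rewrite HF; symmetry; apply ty_sub_up_S.
Qed.

(** Only the elimination of a quantifier needs work: the instance is substituted for the
    eigenvariable in the typing of the body. The other silent rules match the clauses of [lam_ty] by
    computation. *)
Lemma nd_lam_inv E F P t : nd E F (Lam P) t -> lam_ty E F P t.
Proof.
  apply (nd_silent_ind (Lam P) (fun E F t => lam_ty E F P t)); simpl; auto.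
  - intros E0 F0 t0 (s & B & -> & H); exact H.
  - intros E0 F0 A B HB H; eapply lam_lty_tsub; eauto using wf_inst;
      intros; symmetry; apply ty_sub_inst_ren.
Qed.

(** The silent rules act on the type of [N] alone and so move into that premise, while [M] keeps its
    closed type [Par s]. *)
Lemma nd_discard_inv E F s M N t : nd E F (Discard s M N) t ->
  wf_ty (Par s) = true /\ nd E F M (Par s) /\ nd E F N t.
Proof.
  apply (nd_silent_ind (Discard s M N) (fun E F t =>
    wf_ty (Par s) = true /\ nd E F M (Par s) /\ nd E F N t)); auto.
  - intros E0 F0 A (Hs & HM & HN); repeat split; auto using nd_allI.
    (* The typing of [M] has to leave the scope of the eigenvariable; as [s] is closed, the type put
       in its place is arbitrary. *)
    apply (nd_unshift _ _ _ _ (TVar 0)) in HM; auto.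
    simpl in HM; now rewrite ty_sub_wf_par in HM.
  - intros E0 F0 A B HB (Hs & HM & HN); auto using nd_allE.
  - intros E0 F0 u Hu [HE HF] (Hs & HM & HN); repeat split; auto.
    apply nd_p; auto; split; intros.
    + apply HE, in_or_app; auto.
    + apply HF; simpl; lia.
  - intros E0 F0 u (Hs & HM & HN); auto using nd_d.
Qed.

(** As for discards. The two bound indices are no obstacle: their type [Par s] is closed, hence
    fixed by shifting, and meets the side condition of [p]. *)
Lemma nd_copy_inv E F s V M Q t : nd E F (Copy s V M Q) t ->
  wf_ty (Par s) = true /\ value V /\ typing [] V s /\ nd E F M (Par s) /\
  nd E (scons (Par s) (scons (Par s) F)) Q t.
Proof.
  apply (nd_silent_ind (Copy s V M Q) (fun E F t =>
    wf_ty (Par s) = true /\ value V /\ typing [] V s /\ nd E F M (Par s) /\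
    nd E (scons (Par s) (scons (Par s) F)) Q t)); auto.
  - intros E0 F0 A (Hs & HV & TV & HM & HQ); do 3 (split; auto); split.
    + apply (nd_unshift _ _ _ _ (TVar 0)) in HM; auto.
      simpl in HM; now rewrite ty_sub_wf_par in HM.
    + apply nd_allI; eapply nd_ext; eauto.
      intros [|[|i]] _; unfold shift; simpl; auto; now rewrite ty_ren_wf_par.
  - intros E0 F0 A B HB (Hs & HV & TV & HM & HQ); auto 6 using nd_allE.
  - intros E0 F0 u Hu [HE HF] (Hs & HV & TV & HM & HQ); do 4 (split; auto).
    apply nd_p; auto; split; intros.
    + apply HE, in_or_app; auto.
    + destruct i as [|[|i]]; simpl; try (now exists s). apply HF; simpl; lia.
  - intros E0 F0 u (Hs & HV & TV & HM & HQ); auto 6 using nd_d.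
Qed.

(** The silent rules see the subject only through the side condition of [p], which passes to a
    locally closed term with no new free variables. Subject reduction is thereby reduced to
    [nd_core]. *)
Lemma nd_replace M M' :
  lc M' -> incl (fv M') (fv M) ->
  (forall E F t, nd_core E F M t -> nd E F M' t) ->
  forall E F t, nd E F M t -> nd E F M' t.
Proof.
  intros LM' Hfv Hcore; apply nd_silent_ind; auto using nd_allI, nd_allE, nd_d.
  intros E F s Hs [HE HF] H; apply nd_p; auto; split; intros; auto.
  rewrite lc_bcount in H0; auto; lia.
Qed.

(** * Reduction *)

Lemma fcount_lam y x M : fcount y (lam x M) = if x =? y then 0 else fcount y M.
Proof. apply fcount_close. Qed.

Lemma fcount_copy x s V M y z N : fcount x (copy s V M y z N) =
  fcount x M + if z =? x then 0 else if y =? x then 0 else fcount x N.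
Proof. unfold copy; now rewrite fcount_Copy, !fcount_close. Qed.

Lemma lc_lam x M : lc M -> lc (lam x M).
Proof. apply lc_at_close. Qed.

Lemma lc_App M N : lc M -> lc N -> lc (App M N).
Proof. unfold lc; simpl; now intros -> ->. Qed.

Lemma lc_Discard s M N : lc M -> lc N -> lc (Discard s M N).
Proof. unfold lc; simpl; now intros -> ->. Qed.

Lemma lc_copy s V M y z N : lc M -> lc N -> lc (copy s V M y z N).
Proof.
  unfold lc; simpl; intros -> H; simpl; now apply lc_at_close, lc_at_close.
Qed.

Lemma lc_subst x N M : lc N -> lc M -> lc (subst x N M).
Proof. intros; now apply lc_at_subst. Qed.

#[local] Hint Resolve lc_lam lc_App lc_Discard lc_copy lc_subst : lc.

Lemma binders_linear_lam x M : lc M ->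
  binders_linear (lam x M) = true <-> fcount x M = 1 /\ binders_linear M = true.
Proof.
  intros LM; simpl; rewrite binders_linear_close, bcount_close, lc_bcount by auto.
  simpl; now rewrite andb_true_iff, Nat.eqb_eq.
Qed.

Lemma binders_linear_copy s V M y z N : lc N -> y <> z ->
  binders_linear (copy s V M y z N) = true <->
  fcount y N = 1 /\ fcount z N = 1 /\ binders_linear M = true /\ binders_linear N = true.
Proof.
  intros LN Hyz; simpl.
  rewrite !binders_linear_close, !bcount_close, !lc_bcount, fcount_close by auto.
  simpl. rewrite (proj2 (Nat.eqb_neq y z)), Nat.add_0_r by auto.
  rewrite !andb_true_iff, !Nat.eqb_eq; tauto.
Qed.

Lemma redex_lc M M' : redex M M' -> lc M /\ lc M'.
Proof.
  destruct 1; repeat match goal with H : value _ |- _ => destruct H as (_ & ? & _) end;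
    auto 8 with lc.
Qed.

Lemma step_lc M M' : step M M' -> lc M /\ lc M'.
Proof.
  induction 1; try destruct IHstep; auto using redex_lc with lc.
Qed.

Lemma value_fcount V x : value V -> fcount x V = 0.
Proof. intros (_ & _ & H & _); unfold fcount; now rewrite H. Qed.

(** Counts are kept exactly: the argument of an abstraction replaces a single occurrence, and the
    only terms erased or duplicated are values, which have no free variables. *)
Lemma redex_linear M M' : redex M M' -> binders_linear M = true ->
  binders_linear M' = true /\ forall x, fcount x M = fcount x M'.
Proof.
  destruct 1; intros HL.
  - cbn [binders_linear] in HL; apply andb_prop in HL as [HL ?].
    apply binders_linear_lam in HL as [Hx ?]; auto.
    split; [now apply binders_linear_subst|].
    intros y; rewrite fcount_App, fcount_lam, fcount_subst, Hx; lia.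
  - simpl in HL; apply andb_prop in HL as [_ HL]; split; auto.
    intros y; now rewrite fcount_Discard, value_fcount.
  - pose proof H as (_ & LV & _ & _ & _ & BV).
    apply binders_linear_copy in HL as (Hy & Hz & ? & ?); auto.
    split; [auto using binders_linear_subst with lc|].
    intros x; rewrite fcount_copy, !fcount_subst, !(value_fcount V) by auto.
    eqbs; lia.
  - simpl in *; split_andb; split; [rewrite ?andb_true_iff; auto|].
    intros x; autorewrite with fc; lia.
  - simpl in *; split_andb; split; [rewrite ?andb_true_iff; auto|].
    intros x; autorewrite with fc; lia.
  - apply binders_linear_copy in HL as (Hy & Hz & HM & ?); auto.
    cbn [binders_linear] in *; split_andb; split.
    + rewrite andb_true_iff, binders_linear_copy; auto.
    + intros x; rewrite fcount_Discard, !fcount_copy, fcount_Discard; lia.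
  - cbn [binders_linear] in HL; apply andb_prop in HL as [HL ?].
    apply binders_linear_copy in HL as (Hy & Hz & HM & ?); auto.
    rewrite fcount_notIn in *; split.
    + apply binders_linear_copy; auto with lc.
      rewrite !fcount_App; cbn [binders_linear]; rewrite andb_true_iff; repeat split; auto; lia.
    + intros x; rewrite fcount_App, !fcount_copy, fcount_App; eqbs; lia.
  - cbn [binders_linear] in HL; apply andb_prop in HL as [HL ?].
    apply binders_linear_copy in HL as (Hy & Hz & HM & ?); auto.
    rewrite fcount_notIn in *; split.
    + apply binders_linear_copy; auto with lc.
      rewrite !fcount_Discard; cbn [binders_linear]; rewrite andb_true_iff; repeat split; auto; lia.
    + intros x; rewrite fcount_Discard, !fcount_copy, fcount_Discard; eqbs; lia.
  - apply binders_linear_copy in HL as (Hy' & Hz' & HM & ?); auto.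
    apply binders_linear_copy in HM as (Hy & Hz & HM & ?); auto.
    rewrite fcount_notIn in *; split.
    + apply binders_linear_copy; auto with lc.
      rewrite !fcount_copy, binders_linear_copy by auto.
      repeat split; auto; eqbs; lia.
    + intros x; rewrite !fcount_copy; eqbs; lia.
Qed.

Lemma step_linear M M' : step M M' -> binders_linear M = true ->
  binders_linear M' = true /\ forall x, fcount x M = fcount x M'.
Proof.
  induction 1; intros HL; [now apply redex_linear| | | | | | |];
    match goal with H : step _ _ |- _ => pose proof (step_lc _ _ H) as [? ?] end.
  - apply binders_linear_lam in HL as [Hx HL]; auto.
    destruct (IHstep HL) as [? Hc]; split.
    + apply binders_linear_lam; auto; split; auto; now rewrite <- Hc.
    + intros y; now rewrite !fcount_lam, Hc.
  - simpl in *; split_andb; destruct IHstep as [? Hc]; auto; split.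
    + rewrite andb_true_iff; auto.
    + intros; now rewrite !fcount_App, Hc.
  - simpl in *; split_andb; destruct IHstep as [? Hc]; auto; split.
    + rewrite andb_true_iff; auto.
    + intros; now rewrite !fcount_App, Hc.
  - simpl in *; split_andb; destruct IHstep as [? Hc]; auto; split.
    + rewrite andb_true_iff; auto.
    + intros; now rewrite !fcount_Discard, Hc.
  - simpl in *; split_andb; destruct IHstep as [? Hc]; auto; split.
    + rewrite andb_true_iff; auto.
    + intros; now rewrite !fcount_Discard, Hc.
  - apply binders_linear_copy in HL as (? & ? & ? & ?); auto.
    destruct IHstep as [? Hc]; auto; split.
    + apply binders_linear_copy; auto.
    + intros; now rewrite !fcount_copy, Hc.
  - apply binders_linear_copy in HL as (? & ? & ? & ?); auto.
    destruct IHstep as [? Hc]; auto; split.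
    + apply binders_linear_copy; auto; rewrite <- !Hc; auto.
    + intros; now rewrite !fcount_copy, Hc.
Qed.

(** For the exchange of two copies: [P] comes to lie under a second pair of binders, but its only
    dangling indices are the two of its own copy. *)
Lemma nd_copy_weaken E F s u P t :
  lc_at 2 P = true -> nd E (scons s (scons s F)) P t ->
  nd E (scons s (scons s (scons u (scons u F)))) P t.
Proof.
  intros HP H; eapply nd_ext; eauto.
  intros [|[|i]] Hi; simpl; auto.
  rewrite (lc_at_bcount P 2) in Hi; auto; lia.
Qed.

Lemma redex_core M M' : redex M M' -> forall E F t, nd_core E F M t -> nd E F M' t.
Proof.
  destruct 1; intros E F u Hc.
  - destruct Hc as (s & B & -> & HM & HN).
    (* The type of the function is an arrow, so [lam_ty] computes to a typing of the body. *)
    apply nd_lam_inv in HM as [Hs HM].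
    eapply nd_subst; eauto using nd_lam_name.
  - apply Hc.
  - destruct Hc as (Hs & _ & _ & HV & HM). pose proof H as (_ & LV & FV & _).
    apply nd_copy_name in HM; auto.
    eapply nd_subst; eauto with lc. eapply nd_subst; eauto.
    (* The value has no free variable, so the update of the environment at [z] does not affect its
       typing. *)
    eapply nd_ext; eauto. rewrite FV; easy.
  - destruct Hc as (s0 & B & -> & HM & HP).
    apply nd_discard_inv in HM as (? & ? & ?).
    apply nd_discard; auto. eapply nd_app; eauto.
  - destruct Hc as (Hs & HM & HP).
    apply nd_discard_inv in HM as (? & ? & ?).
    apply nd_discard; auto. apply nd_discard; auto.
  - destruct Hc as (Hs & HV & TV & HM & HP).
    apply nd_discard_inv in HM as (? & ? & ?).
    apply nd_discard; auto. apply nd_copy; auto.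
  - destruct Hc as (s0 & B & -> & HM & HP).
    apply nd_copy_inv in HM as (? & ? & ? & ? & HN).
    rewrite fcount_notIn in *.
    apply nd_copy; auto. simpl.
    rewrite (close_fresh y P), (close_fresh z P) by auto.
    eapply nd_app; eauto using nd_lc.
  - destruct Hc as (Hs & HM & HP).
    apply nd_copy_inv in HM as (? & ? & ? & ? & HN).
    rewrite fcount_notIn in *.
    apply nd_copy; auto. simpl.
    rewrite (close_fresh y P), (close_fresh z P) by auto.
    apply nd_discard; eauto using nd_lc.
  - destruct Hc as (Hs & HU & TU & HM & HP).
    apply nd_copy_inv in HM as (? & ? & ? & ? & HN).
    rewrite fcount_notIn in *.
    apply nd_copy; auto. simpl.
    rewrite (close_fresh y (close 1 z' _)), (close_fresh z (close 1 z' (close 0 y' P)))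
      by (rewrite !fcount_close; eqbs; auto).
    apply nd_copy; auto.
    apply nd_copy_weaken; auto. now apply lc_at_close, lc_at_close.
Qed.

(** Environments stay universally quantified in the induction, because a step under a binder is
    taken in an environment updated at the bound names. *)
Lemma nd_step M M' : step M M' -> binders_linear M = true ->
  forall E F t, nd E F M t -> nd E F M' t.
Proof.
  (* A step preserves free variables, so [nd_replace] disposes of the silent rules for every kind of
     step at once. *)
  assert (Hrep : forall M M', step M M' -> binders_linear M = true ->
    (forall E F t, nd_core E F M t -> nd E F M' t) ->
    forall E F t, nd E F M t -> nd E F M' t).
  { intros P P' HS HL Hc; apply nd_replace; auto.
    - now apply step_lc in HS.
    - intros y; rewrite !fcount_In; now rewrite (proj2 (step_linear _ _ HS HL)). }
  induction 1; intros HL; (apply Hrep; [now constructor|exact HL|intros E F t Hc]).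
  - eapply redex_core; eauto.
  - pose proof (step_lc _ _ H) as [? ?].
    apply binders_linear_lam in HL as [_ HL]; auto.
    destruct Hc as (s & B & -> & Hs & HM).
    apply nd_lam; auto.
    apply nd_name_lam; auto. apply IHstep; auto. apply nd_lam_name; auto.
  - simpl in HL; split_andb; destruct Hc as (s & B & -> & HM & HN).
    eapply nd_app; eauto.
  - simpl in HL; split_andb; destruct Hc as (s & B & -> & HM & HN).
    eapply nd_app; eauto.
  - simpl in HL; split_andb; destruct Hc as (Hs & HM & HN).
    apply nd_discard; auto.
  - simpl in HL; split_andb; destruct Hc as (Hs & HM & HN).
    apply nd_discard; auto.
  - apply binders_linear_copy in HL as (? & ? & ? & ?); auto.
    destruct Hc as (Hs & HV & TV & HM & HN).
    apply nd_copy; auto.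
  - pose proof (step_lc _ _ H1) as [? ?].
    apply binders_linear_copy in HL as (? & ? & ? & ?); auto.
    destruct Hc as (Hs & HV & TV & HM & HN).
    apply nd_copy; auto.
    apply nd_name_copy; auto. apply IHstep; auto. apply nd_copy_name; auto.
Qed.

(** * Equivalence with the sequent calculus *)

Lemma typing_wf G M t : typing G M t ->
  Forall (fun d => wf_ty (snd d) = true) G /\ wf_ty t = true.
Proof.
  induction 1; repeat match goal with
  | H : _ /\ _ |- _ => destruct H
  | H : Forall _ (_ :: _) |- _ => inversion H; subst; clear H
  end; simpl in *.
  - auto.
  - split; auto; now apply Forall_app.
  - split; auto; now rewrite andb_true_iff.
  - split; auto; constructor; [simpl; now rewrite andb_true_iff|now apply Forall_app].
  - split; auto. unfold ctx_shift in H0; rewrite Forall_map in H0.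
    eapply Forall_impl; [|exact H0]; simpl; intros; now apply wf_ty_ren_inv.
  - auto.
  - auto.
  - auto.
  - auto.
  - auto.
  - split; auto. rewrite <- H; auto.
Qed.

Notation dcount G x := (count_occ Nat.eq_dec (dom G) x).

Lemma dom_app G D : dom (G ++ D) = dom G ++ dom D.
Proof. apply map_app. Qed.

Lemma dom_ctx_shift G : dom (ctx_shift G) = dom G.
Proof. unfold dom, ctx_shift; rewrite map_map; reflexivity. Qed.

Lemma dcount_cons x s G y : dcount ((x, s) :: G) y = (if x =? y then 1 else 0) + dcount G y.
Proof. apply count_occ_cons_eqb. Qed.

Lemma dcount_app G D y : dcount (G ++ D) y = dcount G y + dcount D y.
Proof. rewrite dom_app; apply count_occ_app. Qed.

Lemma dcount_notIn G x : ~ In x (dom G) -> dcount G x = 0.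
Proof. apply count_occ_not_In. Qed.

Lemma dcount_head x s G : NoDup (dom ((x, s) :: G)) -> dcount G x = 0.
Proof. intros H; inversion H; subst; now apply dcount_notIn. Qed.

(** Even weakening and contraction leave exactly one occurrence of the declared variable, as the
    argument of the discard or the copy. *)
Lemma typing_linear G M t : typing G M t ->
  lc M /\ binders_linear M = true /\ NoDup (dom G) /\ forall x, fcount x M = dcount G x.
Proof.
  induction 1 as [x A HA|G D x N M s t HN IHN HM IHM ND|G x M s B HM IHM
    |G D x y N M s B t HN IHN HM IHM ND|G M A HM IHM|G x M A B t HA HB HM IHM
    |G M s Hs HG HM IHM|G x y M s t Hs HM IHM Hy|G x M s t Hs HM IHM Hx
    |G x y z V M s t HM IHM HV TV _ Hx|G D M t HGD HM IHM];
    try destruct IHN as (LN & BN & NN & CN);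
      try destruct IHM as (LM & BM & NM & CM).
  - repeat split. constructor; auto; constructor.
  - pose proof (dcount_head _ _ _ NM).
    split; [auto with lc|]. split; [now apply binders_linear_subst|]. split; auto.
    intros y; rewrite fcount_subst, !CM, CN, !dcount_cons, dcount_app.
    eqbs; lia.
  - pose proof (dcount_head _ _ _ NM).
    split; [auto with lc|]. split; [|split].
    + apply binders_linear_lam; auto. rewrite CM, dcount_cons, Nat.eqb_refl; auto with arith.
    + now inversion NM.
    + intros y; rewrite fcount_lam, CM, dcount_cons; eqbs; lia.
  - pose proof (dcount_head _ _ _ NM).
    assert (lc (App (FVar y) N)) by now apply lc_App.
    split; [auto with lc|]. split; [now apply binders_linear_subst|]. split; auto.
    intros w; rewrite fcount_subst, fcount_App, fcount_FVar, !CM, CN, !dcount_cons, dcount_app.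
    eqbs; lia.
  - rewrite dom_ctx_shift in *; auto.
  - auto.
  - auto.
  - pose proof (dcount_head _ _ _ NM).
    split; [now apply lc_subst|]. split; [now apply binders_linear_subst|]. split.
    + constructor; auto. now inversion NM.
    + intros w; rewrite fcount_subst, fcount_FVar, !CM, !dcount_cons; eqbs; lia.
  - split; [now apply lc_Discard|]. split; auto. split.
    + now constructor.
    + intros w; rewrite fcount_Discard, fcount_FVar, CM, dcount_cons; auto.
  - inversion NM as [|? ? Hy NM']; subst. inversion NM' as [|? ? Hz NM'']; subst.
    simpl in Hy; apply Decidable.not_or in Hy as [Hyz Hy].
    apply dcount_notIn in Hy, Hz.
    split; [now apply lc_copy|]. split; [|split].
    + apply binders_linear_copy; auto.
      rewrite !CM, !dcount_cons, !Nat.eqb_refl; repeat split; auto; eqbs; lia.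
    + now constructor.
    + intros w; rewrite fcount_copy, fcount_FVar, CM, !dcount_cons; eqbs; lia.
  - split; auto. split; auto. split.
    + eapply Permutation_NoDup; [|exact NM]; now apply Permutation_map.
    + intros x; rewrite CM; apply Permutation_count_occ; now apply Permutation_map.
Qed.

(** * From sequents to natural deduction *)

Definition agree (E : env) (G : ctx) : Prop := forall x s, In (x, s) G -> E x = s.

Lemma agree_cons E G x s : agree E G -> ~ In x (dom G) -> agree (upd E x s) ((x, s) :: G).
Proof.
  intros HE Hx y u [Hy|Hy]; unfold upd.
  - injection Hy as <- <-; now rewrite Nat.eqb_refl.
  - destruct (Nat.eqb_spec x y); [|auto]; subst.
    destruct Hx; now apply (in_map fst) in Hy.
Qed.

Lemma agree_tail E G d : agree E (d :: G) -> agree E G.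
Proof. intros H x s Hx; apply H; now right. Qed.

Lemma agree_cons_typing E G x s M t :
  typing ((x, s) :: G) M t -> agree E G -> agree (upd E x s) ((x, s) :: G).
Proof.
  intros H HE; apply agree_cons; auto.
  apply typing_linear in H as (_ & _ & H & _); now inversion H.
Qed.

Lemma agree_shift E G : agree E G -> agree (shift E) (ctx_shift G).
Proof.
  intros HE x s Hx; apply in_map_iff in Hx as ([y u] & Hyu & Hin).
  injection Hyu as <- <-; unfold shift; f_equal; auto.
Qed.

Lemma nd_hyp E F G x s : agree E ((x, s) :: G) -> wf_ty s = true -> nd E F (FVar x) s.
Proof. intros HE Hs; rewrite <- (HE x s) in * by now left. now apply nd_fvar. Qed.

(** The cut and the left rules for arrows, quantifiers and dereliction all become instances of
    [nd_subst], the substituted term being typed by the matching elimination. *)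
Lemma typing_nd G M t : typing G M t -> forall E F, agree E G -> nd E F M t.
Proof.
  induction 1; intros E F HE.
  - now apply nd_hyp with (G := []).
  - apply nd_subst with s.
    + apply IHtyping2; eapply agree_cons_typing; eauto.
      intros y u Hy; apply HE, in_or_app; auto.
    + apply IHtyping1; intros y u Hy; apply HE, in_or_app; auto.
    + apply typing_linear in H0; tauto.
    + apply typing_linear in H; tauto.
  - apply nd_lam.
    + apply typing_wf in H as [H _]; now inversion H.
    + apply nd_name_lam; [|apply typing_linear in H; tauto].
      apply IHtyping; eapply agree_cons_typing; eauto.
  - pose proof (typing_wf _ _ _ H) as [_ Ws].
    pose proof (typing_wf _ _ _ H0) as [WB _]; inversion WB as [|? ? WB1 _]; simpl in WB1.
    pose proof (typing_linear _ _ _ H) as (LN & _).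
    pose proof (typing_linear _ _ _ H0) as (LM & _).
    pose proof (agree_tail _ _ _ HE) as HE'.
    apply nd_subst with B; [| |auto|now apply lc_App].
    + apply IHtyping2; eapply agree_cons_typing; eauto.
      intros w u Hw; apply HE', in_or_app; auto.
    + apply nd_app with s.
      * eapply nd_hyp; eauto. simpl; now rewrite Ws.
      * apply IHtyping1; intros w u Hw; apply HE', in_or_app; auto.
  - apply nd_allI, IHtyping; now apply agree_shift.
  (* The rule only retypes [x]; this is seen as substituting for [x] the variable [x] itself, typed
     by quantifier elimination. *)
  - rewrite <- (subst_self x M).
    pose proof (typing_linear _ _ _ H1) as (LM & _).
    apply nd_subst with (Lin (lty_inst A B)); auto; [|apply nd_allE; auto|reflexivity].
    + apply IHtyping; eapply agree_cons_typing; eauto using agree_tail.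
    + eapply nd_hyp; eauto.
  - pose proof (typing_linear _ _ _ H1) as (LM & _ & _ & Hc).
    apply nd_p; auto; split.
    + intros x; rewrite fcount_In, Hc; intros Hx.
      apply count_occ_In, in_map_iff in Hx as ([y u] & <- & Hin).
      rewrite Forall_forall in H0; simpl; rewrite (HE _ _ Hin); apply (H0 _ Hin).
    + intros i; rewrite lc_bcount by auto; lia.
  - pose proof (typing_linear _ _ _ H0) as (LM & _).
    apply nd_subst with s; auto; [|apply nd_d|reflexivity].
    + apply IHtyping; eapply agree_cons_typing; eauto using agree_tail.
    + eapply nd_hyp; eauto.
  - apply nd_discard; eauto using agree_tail.
    eapply nd_hyp; eauto.
  - pose proof (typing_wf _ _ _ H) as [W _]; inversion W as [|? ? Ws _]; simpl fst in *.
    pose proof (typing_linear _ _ _ H) as (LM & _ & Hnd & _).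
    inversion Hnd as [|? ? Hy Hnd']; inversion Hnd' as [|? ? Hz _]; subst.
    apply nd_copy; auto.
    + eapply nd_hyp; eauto.
    + apply nd_name_copy; auto. apply IHtyping1.
      apply agree_cons; auto. apply agree_cons; eauto using agree_tail.
  - apply IHtyping; intros x s Hx; apply HE; now rewrite <- H.
Qed.

(** * From natural deduction back to sequents *)

Definition ctx_of (E : env) (l : list nat) : ctx := map (fun x => (x, E x)) l.

Lemma dom_ctx_of E l : dom (ctx_of E l) = l.
Proof. unfold dom, ctx_of; rewrite map_map; apply map_id. Qed.

Lemma ctx_of_app E l l' : ctx_of E (l ++ l') = ctx_of E l ++ ctx_of E l'.
Proof. apply map_app. Qed.

(** The axiom covers linear types only; each modality is added by a dereliction followed by a
    promotion. *)
Lemma typing_id x s : wf_ty s = true -> typing [(x, s)] (FVar x) s.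
Proof.
  induction s as [A|s IH]; intros Hs; [now apply ty_ax|].
  assert (H : typing [(x, Par s)] (FVar x) s).
  { rewrite <- (subst_self x (FVar x)); apply ty_d; auto.
    apply IH; now apply wf_par_wf. }
  apply ty_p; auto. constructor; auto. now exists s.
Qed.

Lemma fresh (l : list nat) : exists x, ~ In x l.
Proof.
  exists (S (list_max l)); intros H.
  pose proof (proj1 (list_max_le l (list_max l)) (le_n _)) as Hl.
  rewrite Forall_forall in Hl; apply Hl in H; lia.
Qed.

(** Simulates the elimination of a quantifier and the rule [d], which retype a subject without
    changing it. The name [x] is alone in its context, so it need not be fresh for [G]. *)
Lemma typing_coerce G M s t x :
  typing G M s -> typing [(x, s)] (FVar x) t -> typing G M t.
Proof.
  intros HM Hx.
  replace M with (subst x M (FVar x)) by (simpl; now rewrite Nat.eqb_refl).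
  rewrite <- (app_nil_r G); eapply ty_cut; eauto.
  rewrite app_nil_r; apply typing_linear in HM; tauto.
Qed.

(** The left rule types the construct on a fresh variable [y], and a cut puts [M] in its place;
    freshness keeps the cut from touching [N]. Discards and copies follow the same pattern. *)
Lemma typing_app G D M N s B : NoDup (dom (G ++ D)) ->
  typing G M (Arr s B) -> typing D N s -> typing (G ++ D) (App M N) B.
Proof.
  intros Hnd HM HN. destruct (fresh (fv N ++ dom D)) as [y Hy].
  rewrite in_app_iff in Hy.
  assert (Hy1 : fcount y N = 0) by (apply fcount_notIn; tauto).
  replace (App M N) with (subst y M (App (FVar y) N))
    by (simpl; now rewrite Nat.eqb_refl, subst_fresh).
  apply ty_cut with (Arr s B); auto.
  replace (App (FVar y) N) with (subst y (App (FVar y) N) (FVar y))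
    by (simpl; now rewrite Nat.eqb_refl).
  rewrite <- (app_nil_r D); apply ty_arrL; auto.
  - apply typing_id. apply typing_wf in HM as [_ HM]; simpl in HM.
    now apply andb_prop in HM.
  - rewrite app_nil_r; constructor; [tauto|].
    apply typing_linear in HN; tauto.
Qed.

Lemma typing_discard G D M N s t : NoDup (dom (G ++ D)) -> wf_ty (Par s) = true ->
  typing G M (Par s) -> typing D N t -> typing (G ++ D) (Discard s M N) t.
Proof.
  intros Hnd Hs HM HN. destruct (fresh (fv N ++ dom D)) as [y Hy].
  rewrite in_app_iff in Hy.
  assert (Hy1 : fcount y N = 0) by (apply fcount_notIn; tauto).
  replace (Discard s M N) with (subst y M (Discard s (FVar y) N))
    by (simpl; now rewrite Nat.eqb_refl, subst_fresh).
  apply ty_cut with (Par s); auto. apply ty_w; auto.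
Qed.

Lemma typing_copy G D V M N s t y z : NoDup (dom (G ++ D)) ->
  value V -> typing [] V s ->
  typing G M (Par s) -> typing ((y, Par s) :: (z, Par s) :: D) N t ->
  typing (G ++ D) (copy s V M y z N) t.
Proof.
  intros Hnd HV TV HM HN. destruct (fresh (fv N ++ dom D)) as [x Hx].
  rewrite in_app_iff in Hx.
  assert (Hx1 : fcount x N = 0) by (apply fcount_notIn; tauto).
  replace (copy s V M y z N) with (subst x M (copy s V (FVar x) y z N)).
  - apply ty_cut with (Par s); auto. apply ty_c; auto.
  - unfold copy; simpl; rewrite Nat.eqb_refl, subst_fresh; auto.
    rewrite !fcount_close; eqbs; auto.
Qed.

Lemma Permutation_fcount (l : list nat) M :
  (forall x, fcount x M = count_occ Nat.eq_dec l x) -> Permutation (fv M) l.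
Proof. intros H; apply (Permutation_count_occ Nat.eq_dec); exact H. Qed.

Lemma ctx_of_upd E x s l : ~ In x l -> ctx_of (upd E x s) l = ctx_of E l.
Proof.
  intros H; apply map_ext_in; intros y Hy; unfold upd.
  destruct (Nat.eqb_spec x y); auto; now subst.
Qed.

(** Induction on size because bodies of binders are opened with fresh names before the hypothesis
    applies. Taking [fv M] as the context makes it split along the subterms, and linearity makes the
    parts disjoint. *)
Lemma nd_typing_size n : forall M, size M < n -> lc M -> linear M ->
  forall E F t, nd E F M t -> typing (ctx_of E (fv M)) M t.
Proof.
  induction n as [|n IH]; [lia|]; intros M Hn LM [ND BL].
  (* For fixed [M], the silent rules go by induction on the derivation; the hypothesis [IH] serves
     for proper subterms. *)
  apply nd_silent_ind.
  - intros E F t Hc; destruct M as [x|i|P|M N|s M N|s V M Q]; cbn [nd_core] in Hc; simpl in Hn, BL.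
    + destruct Hc as [Hw ->]; now apply typing_id.
    + discriminate.
    + destruct Hc as (s & B & -> & Hs & HP).
      apply andb_prop in BL as [B0 BL]; apply Nat.eqb_eq in B0.
      destruct (fresh (fv P)) as [x Hx]. pose proof (proj1 (fcount_notIn _ _) Hx) as Hx0.
      rewrite <- (close_open x P 0) by auto; apply ty_arrR.
      assert (Hp : Permutation (fv (open 0 (FVar x) P)) (x :: fv P)).
      { apply Permutation_fcount; intros y.
        rewrite fcount_open, fcount_FVar, B0, count_occ_cons_eqb.
        unfold fcount; destruct (x =? y); lia. }
      assert (HE : ctx_of (upd E x s) (x :: fv P) = (x, s) :: ctx_of E (fv P)).
      { simpl; rewrite ctx_of_upd by auto; unfold upd; now rewrite Nat.eqb_refl. }
      simpl fv; rewrite close_open, <- HE by auto.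
      eapply ty_exch; [apply Permutation_map, Hp|].
      apply IH with F.
      * rewrite size_open; lia.
      * now apply lc_at_open.
      * split; [|now rewrite binders_linear_open].
        apply Permutation_sym, Permutation_NoDup in Hp; auto. now constructor.
      * apply (nd_lam_name E F _ s B x); auto; [now rewrite close_open|].
        now apply lc_at_open.
    + destruct Hc as (s & B & -> & HM & HN).
      unfold lc in LM; simpl in LM, ND |- *; split_andb.
      rewrite ctx_of_app.
      apply typing_app with s.
      * now rewrite <- ctx_of_app, dom_ctx_of.
      * apply IH with F; auto; try lia. split; eauto using NoDup_app_remove_r.
      * apply IH with F; auto; try lia. split; eauto using NoDup_app_remove_l.
    + destruct Hc as (Hs & HM & HN).
      unfold lc in LM; simpl in LM, ND |- *; split_andb.
      rewrite ctx_of_app.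
      apply typing_discard; auto.
      * now rewrite <- ctx_of_app, dom_ctx_of.
      * apply IH with F; auto; try lia. split; eauto using NoDup_app_remove_r.
      * apply IH with F; auto; try lia. split; eauto using NoDup_app_remove_l.
    + destruct Hc as (Hs & HV & TV & HM & HQ).
      unfold lc in LM; simpl in LM, ND |- *; split_andb.
      rewrite Nat.eqb_eq in *.
      rewrite ctx_of_app.
      destruct (fresh (fv Q)) as [y Hy]. destruct (fresh (y :: fv Q)) as [z Hz].
      pose proof (proj1 (fcount_notIn _ _) Hy) as Hy0.
      assert (Hyz : y <> z) by (intros ->; apply Hz; now left).
      assert (Hz0 : fcount z Q = 0)
        by (apply fcount_notIn; intros ?; apply Hz; now right).
      (* A named body, chosen so that the term reads as [copy s V M y z N], the form required by
         [typing_copy]. *)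
      set (N := open 0 (FVar y) (open 1 (FVar z) Q)).
      assert (HQN : close 1 z (close 0 y N) = Q).
      { unfold N; rewrite !close_open; auto.
        rewrite fcount_open, fcount_FVar; eqbs; congruence || lia. }
      assert (LN : lc N) by now apply lc_at_open, lc_at_open.
      assert (Hp : Permutation (fv N) (y :: z :: fv Q)).
      { apply Permutation_fcount; intros x; unfold N.
        rewrite !fcount_open, bcount_open, !fcount_FVar, !count_occ_cons_eqb by reflexivity.
        simpl; unfold fcount; eqbs; lia. }
      assert (HE : ctx_of (upd (upd E z (Par s)) y (Par s)) (y :: z :: fv Q) =
        (y, Par s) :: (z, Par s) :: ctx_of E (fv Q)).
      { simpl; rewrite !ctx_of_upd; auto; [|intros ?; apply Hz; now right].
        unfold upd; rewrite !Nat.eqb_refl. now destruct (y =? z). }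
      rewrite <- HQN at 2. fold (copy s V M y z N).
      apply typing_copy; auto.
      * now rewrite <- ctx_of_app, dom_ctx_of.
      * apply IH with F; auto; try lia. split; eauto using NoDup_app_remove_r.
      * rewrite <- HE. eapply ty_exch; [apply Permutation_map, Hp|].
        apply IH with F; auto.
        -- unfold N; rewrite !size_open; lia.
        -- split; [|unfold N; now rewrite !binders_linear_open].
           apply Permutation_sym, Permutation_NoDup in Hp; auto.
           repeat constructor; eauto using NoDup_app_remove_l.
           ++ intros [?|?]; auto.
           ++ intros ?; apply Hz; now right.
        -- apply nd_copy_name; auto. now rewrite HQN.
  - intros E F A H; apply ty_allR.
    unfold ctx_shift, ctx_of in *; now rewrite map_map.
  - intros E F A B HB H.
    pose proof (typing_wf _ _ _ H) as [_ HA]; simpl in HA.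
    apply typing_coerce with (Lin (All A)) 0; auto.
    apply ty_allL with B; auto. apply typing_id. now apply wf_lty_ty_sub; [|apply wf_inst].
  - intros E F s Hs [HE _] H; apply ty_p; auto.
    unfold ctx_of; rewrite Forall_map, Forall_forall; auto.
  - intros E F s H. pose proof (typing_wf _ _ _ H) as [_ Hs].
    apply typing_coerce with (Par s) 0; auto.
    rewrite <- (subst_self 0 (FVar 0)); apply ty_d; auto.
    apply typing_id; now apply wf_par_wf.
Qed.

Theorem theorem5p16 (G : ctx) (M M' : term) (t : ty) :
  typing G M t -> step M M' -> typing G M' t.
Proof.
  intros HT HS.
  destruct (typing_linear _ _ _ HT) as (LM & BM & ND & HC).
  destruct (step_linear _ _ HS BM) as [BM' HC'].
  (* The default is never reached on names declared in [G], and since these are distinct the first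
     match is the only one. *)
  set (E := fun x => match find (fun d => fst d =? x) G with
                     | Some d => snd d | None => Lin (TVar 0) end).
  assert (HE : agree E G).
  { clear -ND; subst E; induction G as [|[x s] G IH]; intros y u Hy; [easy|].
    inversion ND as [|? ? Hx ND']; subst; simpl.
    destruct Hy as [Hy|Hy].
    - injection Hy as -> ->; now rewrite Nat.eqb_refl.
    - destruct (Nat.eqb_spec x y); [subst|now apply IH].
      destruct Hx; now apply (in_map fst) in Hy. }
  (* Reduction may reorder the free variables but keeps their multiplicities, so the final context
     differs from [G] by an exchange. *)
  assert (Hp : Permutation (fv M') (dom G)).
  { apply Permutation_fcount; intros x; now rewrite <- HC', HC. }
  apply ty_exch with (ctx_of E (fv M')).
  - transitivity (ctx_of E (dom G)); [now apply Permutation_map|].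
    unfold ctx_of, dom; rewrite map_map.
    erewrite map_ext_in; [rewrite map_id; reflexivity|].
    intros [x s] Hin; simpl; f_equal; now apply HE.
  - apply (nd_typing_size (S (size M'))) with E; auto.
    + now apply step_lc in HS.
    + split; auto. eapply Permutation_NoDup; [symmetry; exact Hp|auto].
    + eapply nd_step; eauto. now apply typing_nd with G.
Qed.
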